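(* Let $\mathcal{D}$ be any probability distribution over pairs $(x,y)$ with $x\in\mathcal{X}$ and $y\in\mathcal{Y}(x)$, let $m\ge 1$, $\delta\in(0,1)$, and let $\beta=\beta(m,w)>0$ be any scale parameter, possibly depending on $m$ and $w$. With probability at least $1-\delta$ over a sample $S=\{(x_i,y_i)\}_{i=1}^m$ drawn i.i.d. from $\mathcal{D}$, simultaneously for all $w\in\mathcal{W}$: $$L(w,\mathcal{D})\le L(w,S)+2\sqrt{\frac{s(\ln d+2\ln(mr))}{m}}+3\sqrt{\frac{\ln(2/\delta)}{2m}}.$$
   Context: Setting: $\mathcal{X}$ is an input space; for each $x\in\mathcal{X}$, $\mathcal{Y}(x)$ is a finite nonempty set of structured outputs with $|\mathcal{Y}(x)|\le r$. A joint feature map $\phi(x,y)\in\mathbb{R}^d$ is given, and every nonzero coordinate of every $\phi(x,y)$ is at least $1$. $\mathcal{W}$ denotes the set of $s$-sparse vectors in $\mathbb{R}^d$ (at most $s$ nonzero coordinates). $\mathcal{G}(\beta)$ is the Gumbel distribution with location $0$ and scale $\beta$ (CDF $t\mapsto\exp(-e^{-t/\beta})$). For $w\in\mathbb{R}^d$ and $\gamma=(\gamma_y)_{y\in\mathcal{Y}(x)}$ with i.i.d. $\mathcal{G}(\beta)$ entries, the stochastic decoder is $f_{w,\gamma}(x)=\arg\max_{y\in\mathcal{Y}(x)}\langle\phi(x,y),w\rangle+\gamma_y$ (ties have probability zero); equivalently $\Pr_\gamma[f_{w,\gamma}(x)=y]=\exp(\langle\phi(x,y),w\rangle/\beta)/\sum_{y'\in\mathcal{Y}(x)}\exp(\langle\phi(x,y'),w\rangle/\beta)$.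 Losses: $L(w,\mathcal{D})=\mathbb{E}_{(x,y)\sim\mathcal{D}}\Pr_\gamma[f_{w,\gamma}(x)\ne y]$ and, for $S=\{(x_i,y_i)\}_{i=1}^m$, the CRF loss $L(w,S)=\frac1m\sum_{i=1}^m\Pr_\gamma[f_{w,\gamma}(x_i)\ne y_i]$, where $\gamma$ has scale $\beta=\beta(m,w)$. *)

(* Defs.v *)
From HB Require Import structures.
From mathcomp Require Import all_boot all_order all_algebra.
From mathcomp Require Import all_classical all_reals all_analysis.
Set Implicit Arguments. Unset Strict Implicit. Unset Printing Implicit Defensive.
Import Order.TTheory GRing.Theory Num.Theory.
Local Open Scope classical_set_scope.
Local Open Scope ring_scope.

Definition inner (R : realType) (d : nat) (u v : 'rV[R]_d) : R :=
  \sum_(i < d) u ord0 i * v ord0 i.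

Definition sparse (R : realType) (d s : nat) (w : 'rV[R]_d) : Prop :=
  (#|[set i : 'I_d | w ord0 i != 0%R]| <= s)%N.

(* Pr_gamma[f_{w,gamma}(x) = y] for the Gumbel(beta) perturbed argmax decoder,
   given by the Gibbs/softmax formula stated in the context;
   it is 0 when y is not in Y(x). *)
Definition gibbs_prob (R : realType) (X : Type) (Y : eqType) (d : nat)
  (phi : X -> Y -> 'rV[R]_d) (Yx : X -> seq Y) (beta : R) (w : 'rV[R]_d)
  (x : X) (y : Y) : R :=
  if y \in Yx x then
    expR (inner (phi x y) w / beta) /
      \sum_(y' <- Yx x) expR (inner (phi x y') w / beta)
  else 0.

Definition err (R : realType) (X : Type) (Y : eqType) (d : nat)
  (phi : X -> Y -> 'rV[R]_d) (Yx : X -> seq Y) (beta : R) (w : 'rV[R]_d)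
  (z : X * Y) : R :=
  1 - gibbs_prob (Y := Y) phi Yx beta w z.1 z.2.

Definition mutually_independent (dO dT : measure_display) (Om : measurableType dO)
  (T : measurableType dT) (R : realType) (P : probability Om R) (m : nat)
  (Z : 'I_m -> Om -> T) : Prop :=
  forall B : 'I_m -> set T, (forall i, measurable (B i)) ->
    P (\bigcap_(i in [set: 'I_m]) (Z i @^-1` B i)) =
    (\prod_(i < m) P (Z i @^-1` B i))%E.

(* Main.v *)
Require Import Defs.
From HB Require Import structures.
From mathcomp Require Import all_boot all_order all_algebra.
From mathcomp Require Import all_classical all_reals all_analysis.
From mathcomp Require Import measurable_realfun.
From mathcomp Require Import zify ring lra.
Set Implicit Arguments. Unset Strict Implicit. Unset Printing Implicit Defensive.
Import Order.TTheory GRing.Theory Num.Theory.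
Import numFieldNormedType.Exports.
Local Open Scope classical_set_scope.
Local Open Scope ring_scope.

(** Symmetrization with an exponential moment: Jensen's inequality bounds
    the moment of the uniform deviation by that of a difference with a ghost
    sample, and swapping the two samples coordinatewise introduces Rademacher
    signs.  By the Gumbel-max representation each softmax probability is an
    average, over noise shared by all [w], of indicators of intersections of
    halfspaces [inner u (w / beta) <= g].  On [2 m] points there are at most
    [2 m (r - 1)] such halfspaces for each value of the noise, so by Sauer-Shelah
    the [s]-sparse vectors realize at most
    [d ^ s * (2 m (r - 1) + 1) ^ s <= d ^ s * (m r) ^ (2 s)] sign patterns, and a
    union bound over these patterns concludes.  The argument is carried out with
    finite sums: the noise is discretized, and for finitely many [w] the sample
    space is quantized into cells on which all losses are almost constant.  A
    countable family of vectors that is dense for [w |-> (w / beta, L w)] and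
    continuity of the measure from below give the statement for all [w]. *)

(** * Shattering and the Sauer-Shelah count *)

Definition shatters (T : finType) (C : {set {set T}}) (S : {set T}) : bool :=
  [forall A : {set T}, (A \subset S) ==> [exists B in C, B :&: S == A]].

Lemma shattersP (T : finType) (C : {set {set T}}) (S : {set T}) :
  reflect (forall A : {set T}, A \subset S -> exists2 B, B \in C & B :&: S = A)
          (shatters C S).
Proof.
apply: (iffP forallP) => [h A AS|h A].
  by have /implyP/(_ AS)/existsP[B /andP[BC /eqP BS]] := h A; exists B.
apply/implyP => /h[B BC BS]; apply/existsP; exists B.
by rewrite BC BS eqxx.
Qed.

Lemma shattersS (T : finType) (C C' : {set {set T}}) (S : {set T}) :
  C \subset C' -> shatters C S -> shatters C' S.
Proof.
move=> /fintype.subsetP CC' /shattersP h; apply/shattersP => A /h[B BC BS].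
by exists B => //; exact: CC'.
Qed.

(* Pajor's strengthening of the Sauer-Shelah lemma: the induction splits the
   family along an element that separates two of its members. *)
Lemma card_le_shattered (T : finType) (C : {set {set T}}) :
  (#|C| <= #|[set S | shatters C S]%SET|)%N.
Proof.
elim/ltn_ind: {C}#|C| {-2}C (erefl #|C|) => n IH C Cn.
have [C1|] := leqP n 1.
  rewrite -Cn in C1 *; have [->//|C0] := posnP #|C|.
  have /cards1P[B CB] : #|C| == 1%N by rewrite eqn_leq C1.
  rewrite [X in (X <= _)%N](_ : _ = 1%N); last by rewrite CB cards1.
  rewrite card_gt0; apply/set0Pn; exists finset.set0; rewrite inE.
  apply/shattersP => A; rewrite finset.subset0 => /eqP ->.
  by exists B; rewrite ?CB ?inE ?finset.setI0.
rewrite -Cn => /card_gt1P[B1 [B2 [B1C B2C B12]]].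
have [x xB] : exists x, (x \in B1) != (x \in B2).
  apply/existsP; rewrite -negb_forall; apply: contra B12 => /forallP h.
  by apply/eqP/setP => x; apply/eqP.
pose C0 := [set B in C | x \notin B]%SET; pose C1 := [set B in C | x \in B]%SET.
have C01 : C = C1 :|: C0.
  by apply/setP => B; rewrite !inE; case: (B \in C); case: (x \in B).
have dC : C1 :&: C0 = finset.set0.
  apply/setP => B; rewrite !inE.
  by case: (B \in C); case: (x \in B).
have cC : #|C| = (#|C1| + #|C0|)%N.
  by rewrite {1}C01 cardsU dC cards0 subn0.
have [C1p C0p] : (0 < #|C1|)%N /\ (0 < #|C0|)%N.
  rewrite !card_gt0; split; apply/set0Pn.
    move: xB; case e1 : (x \in B1) => xB; first by exists B1; rewrite inE B1C e1.
    by exists B2; rewrite inE B2C; case: (x \in B2) xB.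
  move: xB; case e1 : (x \in B1) => xB; last by exists B1; rewrite inE B1C e1.
  by exists B2; rewrite inE B2C; case: (x \in B2) xB.
have h1 := IH #|C1| ltac:(lia) C1 erefl.
have h0 := IH #|C0| ltac:(lia) C0 erefl.
have C1S : C1 \subset C by rewrite C01 finset.subsetUl.
have C0S : C0 \subset C by rewrite C01 finset.subsetUr.
set S1 := [set S | shatters C1 S]%SET in h1; set S0 := [set S | shatters C0 S]%SET in h0.
(* Neither half can shatter a set containing [x], since all its members agree on [x]. *)
have x1 S : S \in S1 -> x \notin S.
  rewrite inE => /shattersP/(_ finset.set0 (finset.sub0set _))[B].
  rewrite inE => /andP[_ xB'] /setP/(_ x); rewrite !inE xB' /= => ->.
  by [].
have x0 S : S \in S0 -> x \notin S.
  rewrite inE => /shattersP h; apply/negP => xS.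
  have := h S (subxx _) => -[B]; rewrite inE => /andP[_ xB'] /setP/(_ x).
  by rewrite !inE xS (negbTE xB').
have inj : {in S1 :&: S0 &, injective (fun S => x |: S)}.
  move=> S S'; rewrite !inE => /andP[_ hS] /andP[_ hS'] /(congr1 (fun E => E :\ x)).
  by rewrite !setU1K// x0// inE.
(* A set shattered by both halves stays shattered by [C] once [x] is added, so it counts twice. *)
have sub : (S1 :|: S0) :|: [set x |: S | S in S1 :&: S0]%SET \subset [set S | shatters C S]%SET.
  apply/fintype.subsetP => S; rewrite !inE => /orP[/orP[]|].
  - exact: shattersS.
  - exact: shattersS.
  case/imsetP => S'; rewrite !inE => /andP[hS1 hS0] ->.
  have xS' : x \notin S' by apply: x0; rewrite inE.
  apply/shattersP => A AS.
  have AS' : A :\ x \subset S' by rewrite finset.subDset.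
  case xA : (x \in A).
    have [B BC1 BS] := shattersP _ _ hS1 _ AS'.
    exists B; first exact: (fintype.subsetP C1S).
    move: BC1; rewrite inE => /andP[_ xB'].
    rewrite finset.setIUr BS.
    have -> : B :&: [set x]%SET = [set x]%SET.
      by apply/eqP; rewrite finset.eqEsubset finset.subsetIr finset.subsetI finset.sub1set xB' subxx.
    by rewrite finset.setD1K.
  have [B BC0 BS] := shattersP _ _ hS0 _ AS'.
  exists B; first exact: (fintype.subsetP C0S).
  move: BC0; rewrite inE => /andP[_ xB'].
  rewrite finset.setIUr BS; apply/setP => y; rewrite !inE.
  by case: (eqVneq y x) => [->|]; rewrite ?xA ?(negbTE xB') ?andbF.
have dis : (S1 :|: S0) :&: [set x |: S | S in S1 :&: S0]%SET = finset.set0.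
  apply/setP => S; rewrite !inE; apply/negbTE/negP.
  move=> /andP[/orP hS /imsetP[S' _ SE]].
  have : x \in S by rewrite SE setU11.
  by apply/negP; case: hS => hS; [apply: x1|apply: x0]; rewrite inE.
have := subset_leq_card sub.
rewrite [X in (X <= _)%N]cardsU dis cards0 subn0.
rewrite card_in_imset // => h; have := cardsUI S1 S0; lia.
Qed.

(** A set of at most [s] elements is read off [s] slots, each holding an element or [None]; hence
    the base [#|T|.+1]. *)
Lemma card_small_sets (T : finType) (s : nat) :
  (#|[set S : {set T} | #|S| <= s]%SET| <= #|T|.+1 ^ s)%N.
Proof.
pose F (f : {ffun 'I_s -> option T}) := [set x | Some x \in codom f]%SET.
have -> : (#|T|.+1 ^ s)%N = #|{: {ffun 'I_s -> option T}}|.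
  by rewrite card_ffun card_option card_ord.
rewrite -cardsT; apply: leq_trans (leq_imset_card F _).
apply/subset_leq_card/fintype.subsetP => S; rewrite inE => Ss.
apply/imsetP; exists [ffun i : 'I_s => onth (enum S) i]; rewrite ?inE//.
apply/setP => x; rewrite inE; apply/idP/codomP => [xS|[i]].
  have xi : (index x (enum S) < s)%N.
    by apply: leq_trans Ss; rewrite cardE index_mem mem_enum.
  exists (Ordinal xi); rewrite ffunE/= onthE (nth_map x) ?nth_index ?mem_enum//.
  by rewrite index_mem mem_enum.
rewrite ffunE => /esym xi; rewrite -mem_enum; apply/onthP.
by exists i.
Qed.

(** * Sign patterns of sparse vectors on halfspaces *)

(** A matrix with [s] columns and more than [s] rows has a nonzero left kernel, one row of which
    gives the coefficients. *)
Lemma linear_dependency (R : realType) (J : finType) (S : {set J}) (s : nat)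
    (a : J -> 'I_s -> R) : (s < #|S|)%N ->
  exists c : J -> R, (exists2 j, j \in S & c j != 0) /\
    forall i, \sum_(j in S) c j * a j i = 0.
Proof.
move=> sS; pose A : 'M[R]_(#|S|, s) := \matrix_(p, i) a (enum_val p) i.
have : kermx A != 0.
  rewrite kermx_eq0 /row_free; apply/eqP => rk.
  by have := rank_leq_col A; rewrite rk leqNgt sS.
case/matrix0Pn => p [q Apq].
have [x0 x0S] : exists x, x \in S by apply/card_gt0P; apply: leq_ltn_trans sS.
pose c j := kermx A p (enum_rank_in x0S j).
exists c; split.
  exists (enum_val q); first exact: enum_valP.
  by rewrite /c enum_valK_in.
move=> i; have := congr1 (fun M : matrix _ _ _ => M p i) (mulmx_ker A).
rewrite mxE [X in _ = X]mxE => ker; rewrite -[RHS]ker big_enum_val /=.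
by apply: eq_bigr => t _; rewrite /c enum_valK_in [A t i]mxE.
Qed.

Lemma sum_inner_eq0 (R : realType) (J : finType) (S : {set J}) (d s : nat)
    (f : 'I_s -> 'I_d) (u : J -> 'rV[R]_d) (c : J -> R) (v : 'rV[R]_d) :
  (forall i, v ord0 i != 0 -> i \in codom f) ->
  (forall i, \sum_(j in S) c j * u j ord0 (f i) = 0) ->
  \sum_(j in S) c j * inner (u j) v = 0.
Proof.
move=> vf cf.
under eq_bigr do rewrite /inner mulr_sumr.
rewrite exchange_big /= big1// => i _.
under eq_bigr do rewrite mulrA.
rewrite -mulr_suml; have [->|/vf/codomP[l ->]] := eqVneq (v ord0 i) 0.
  by rewrite mulr0.
by rewrite cf mul0r.
Qed.

(* A linear dependency [c] of more than [s] restricted normals makes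
   [\sum_j c j * (g j - inner (u j) v)] independent of [v], so that its sign
   rules out one of the sign patterns. *)
Lemma halfspaces_shatter_le (R : realType) (J K : finType) (d s : nat)
    (f : 'I_s -> 'I_d) (u : J -> 'rV[R]_d) (g : J -> R) (v : K -> 'rV[R]_d)
    (L : {set K}) (S : {set J}) :
  (forall k, k \in L -> forall i, v k ord0 i != 0 -> i \in codom f) ->
  shatters [set [set j | inner (u j) (v k) <= g j]%SET | k in L]%SET S ->
  (#|S| <= s)%N.
Proof.
move=> vf /shattersP sh; rewrite leqNgt; apply/negP => sS.
have [c0 [[j0 j0S cj0] c0f]] := linear_dependency (fun j i => u j ord0 (f i)) sS.
(* The sign of [c0] is flipped if necessary: a zero constant term contradicts only a strictly
   negative sum, which needs a positive coefficient. *)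
have [c [cf cC]] : exists c : J -> R, (forall i, \sum_(j in S) c j * u j ord0 (f i) = 0) /\
    (0 < \sum_(j in S) c j * g j \/
     (0 <= \sum_(j in S) c j * g j /\ exists2 j, j \in S & 0 < c j)).
  have Ncf i : \sum_(j in S) - c0 j * u j ord0 (f i) = 0.
    by under eq_bigr do rewrite mulNr; rewrite sumrN c0f oppr0.
  have NC : \sum_(j in S) - c0 j * g j = - \sum_(j in S) c0 j * g j.
    by rewrite -sumrN; apply: eq_bigr => j _; rewrite mulNr.
  have [C0|C0|C0] := ltgtP 0 (\sum_(j in S) c0 j * g j).
  - by exists c0; split; [|left].
  - by exists (fun j => - c0 j); split => //; left; rewrite NC oppr_gt0.
  have [cp|cn] := ltP 0 (c0 j0).
    by exists c0; split; [|right; split; [rewrite -C0|exists j0]].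
  exists (fun j => - c0 j); split => //; right; split; first by rewrite NC -C0 oppr0.
  by exists j0; rewrite // oppr_gt0 lt_neqAle cj0.
(* A vector realizing this pattern makes every term [c j * (g j - inner (u j) (v k))] nonpositive,
   and negative where [0 < c j]. *)
have [_ /imsetP[k kL ->] kS] := sh [set j in S | c j <= 0]%SET
  ltac:(apply/fintype.subsetP => j; rewrite inE => /andP[]//).
have sg j : j \in S -> (inner (u j) (v k) <= g j) = (c j <= 0).
  by move=> jS; move/setP/(_ j): kS; rewrite !inE jS andbT.
have eqC : \sum_(j in S) c j * (g j - inner (u j) (v k)) = \sum_(j in S) c j * g j.
  under eq_bigr do rewrite mulrBr.
  by rewrite sumrB (sum_inner_eq0 (vf k kL) cf) subr0.
have le0 j : j \in S -> c j * (g j - inner (u j) (v k)) <= 0.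
  move=> jS; have [cj|cj] := leP (c j) 0.
    by rewrite mulr_le0_ge0// subr_ge0 sg.
  rewrite mulr_ge0_le0 ?ltW// subr_lt0 ltNge sg// -ltNge//.
case: cC => [C0|[C0 [j jS cj]]].
  by move: C0; rewrite -eqC ltNge sumr_le0.
move: C0; rewrite -eqC leNgt => /negP; apply.
rewrite (bigD1 j)//=; apply: ltr_wnDr.
  by rewrite sumr_le0// => i /andP[iS _]; exact: le0.
by rewrite pmulr_rlt0// subr_lt0 ltNge sg// -ltNge.
Qed.

(** The nonzero coordinates fill at most [s] slots; the other slots repeat coordinate [0], which
    exists because [0 < d]. *)
Lemma sparse_support (R : realType) (d s : nat) (v : 'rV[R]_d) :
  (0 < d)%N -> sparse s v ->
  exists f : {ffun 'I_s -> 'I_d}, forall i, v ord0 i != 0 -> i \in codom f.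
Proof.
move=> d0 vs; pose e := enum [set i : 'I_d | v ord0 i != 0%R].
exists [ffun i : 'I_s => nth (Ordinal d0) e i] => i vi.
have ie : i \in e by rewrite mem_enum; apply: mem_set.
have ilt : (index i e < s)%N.
  by apply: leq_trans vs; rewrite /= cardE index_mem.
by apply/codomP; exists (Ordinal ilt); rewrite ffunE/= nth_index.
Qed.

(** There are [d ^ s] choices of slots [f]; for each, only sets of at most [s] halfspaces are
    shattered, and Pajor's lemma applies. *)
Lemma card_halfspace_patterns (R : realType) (J K : finType) (d s : nat)
    (u : J -> 'rV[R]_d) (g : J -> R) (v : K -> 'rV[R]_d) :
  (0 < d)%N -> (forall k, sparse s (v k)) ->
  (#|[set [set j | (inner (u j) (v k) <= g j)%R]%SET | k in K]%SET| <= d ^ s * #|J|.+1 ^ s)%N.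
Proof.
move=> d0 vs.
pose L (f : {ffun 'I_s -> 'I_d}) :=
  [set k | [forall i, (v k ord0 i != 0) ==> (i \in codom f)]]%SET.
pose pat k := [set j | inner (u j) (v k) <= g j]%SET.
have sub : [set pat k | k in K]%SET \subset
    (\bigcup_(f : {ffun 'I_s -> 'I_d}) [set pat k | k in L f])%SET.
  apply/fintype.subsetP => _ /imsetP[k _ ->].
  have [f vf] := sparse_support d0 (vs k).
  apply/finset.bigcupP; exists f => //; apply: imset_f; rewrite inE.
  by apply/forallP => i; apply/implyP; exact: vf.
apply: leq_trans (subset_leq_card sub) _.
apply: (@leq_trans (\sum_(f : {ffun 'I_s -> 'I_d}) #|J|.+1 ^ s)%N); last first.
  by rewrite sum_nat_const card_ffun !card_ord.
elim/big_rec2 : _ => [|f n A _ IH]; first by rewrite cards0.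
apply: leq_trans (leq_card_setU _ _) _; apply: leq_add => //.
apply: leq_trans (card_le_shattered _) _.
apply: leq_trans (card_small_sets J s); apply: subset_leq_card.
apply/fintype.subsetP => S; rewrite !inE; apply: halfspaces_shatter_le.
by move=> k; rewrite inE => /forallP h i; exact/implyP.
Qed.

(** * Riemann sums and discretized Gumbel noise *)

Lemma expR_ge_tangent (R : realType) (x y : R) : expR x * (1 + (y - x)) <= expR y.
Proof.
rewrite -[in leRHS](subrK x y) expRD mulrC ler_wpM2r ?expR_ge0//.
exact: expR_ge1Dx.
Qed.

(** Bernoulli's inequality with base [expR u]: the tangent at [u] is evaluated at [a * u] and, with
    weight [a - 1], at [0]. *)
Lemma expR_bernoulli (R : realType) (a u : R) :
  1 <= a -> a * (expR u - 1) <= expR (a * u) - 1.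
Proof.
move=> a1; have h1 := expR_ge_tangent u (a * u).
have := expR_ge_tangent u 0; rewrite expR0 => h0.
have := ler_wpM2l (_ : 0 <= a - 1) h0; rewrite subr_ge0 a1 => /(_ isT).
by move: h1; set E := expR u; set F := expR (a * u) => h1 h2; lra.
Qed.

Lemma powR_tangent (R : realType) (S x y : R) : 0 <= S -> 0 < x -> 0 < y ->
  (1 + S) * (expR (S * ln x) * (y - x)) <=
    expR ((1 + S) * ln y) - expR ((1 + S) * ln x).
Proof.
move=> S0 x0 y0; have := @expR_bernoulli R (1 + S) (ln y - ln x).
rewrite lerDl S0 => /(_ isT).
rewrite [(1 + S) * (ln y - ln x)]mulrBr !expRB !lnK ?posrE//.
have e : expR ((1 + S) * ln x) = x * expR (S * ln x).
  by rewrite mulrDl mul1r expRD lnK ?posrE.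
rewrite -(ler_pM2r (expR_gt0 ((1 + S) * ln x))) [leRHS]mulrBl mul1r divfK ?gt_eqF ?expR_gt0//.
apply: le_trans; rewrite e le_eqVlt; apply/orP; left; apply/eqP.
by field; rewrite gt_eqF.
Qed.

Section RiemannSum.
Variables (R : realType) (n : nat) (S : R).
Hypotheses (n0 : (0 < n)%N) (S0 : 0 <= S).

(** For [k < n] the nodes lie strictly inside the unit interval, so their logarithms are negative.
    [F] samples a primitive of [(1 + S) * x ^ S]. *)
Let x (k : nat) : R := k.+1%:R / n.+1%:R.
Let F (k : nat) : R := expR ((1 + S) * ln (x k)).
Let f (k : nat) : R := expR (S * ln (x k)).

Let x_gt0 k : 0 < x k. Proof. by rewrite divr_gt0. Qed.

Let xS k : x k.+1 - x k = n.+1%:R^-1.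
Proof. by rewrite /x -mulrBl -natrB// subSnn mul1r. Qed.

Let xn : x n = 1. Proof. by rewrite /x divff. Qed.

Let Fn : F n = 1. Proof. by rewrite /F xn ln1 mulr0 expR0. Qed.
Let fn : f n = 1. Proof. by rewrite /f xn ln1 mulr0 expR0. Qed.

Let up k : (1 + S) * (f k * n.+1%:R^-1) <= F k.+1 - F k.
Proof. by rewrite -(xS k); exact: powR_tangent. Qed.

Let lo k : F k.+1 - F k <= (1 + S) * (f k.+1 * n.+1%:R^-1).
Proof.
rewrite -(xS k); have := powR_tangent S0 (x_gt0 k.+1) (x_gt0 k).
by rewrite -lerN2 opprB -[x k - _]opprB mulrN mulrN opprK.
Qed.

Let sum_up : (1 + S) * n.+1%:R^-1 * \sum_(k < n) f k <= 1.
Proof.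
have : \sum_(0 <= k < n) (F k.+1 - F k) <= 1.
  by rewrite telescope_sumr// Fn gerBl expR_ge0.
apply: le_trans; rewrite big_mkord mulr_sumr; apply: ler_sum => k _.
by rewrite -mulrA [_^-1 * _]mulrC up.
Qed.

Let F0 : F 0%N <= (1 + S) * (f 0%N * n.+1%:R^-1).
Proof.
have -> : F 0%N = f 0%N * n.+1%:R^-1.
  by rewrite /F mulrDl mul1r expRD lnK ?posrE// mulrC /f /x mul1r.
by rewrite ler_peMl ?mulr_ge0 ?expR_ge0// lerDl.
Qed.

Let sum_lo : 1 - (1 + S) * n.+1%:R^-1 <= (1 + S) * n.+1%:R^-1 * \sum_(k < n) f k.
Proof.
have h k : F k <= (1 + S) * n.+1%:R^-1 * \sum_(i < k.+1) f i.
  elim: k => [|k IH]; first by rewrite big_ord1 -mulrA [_^-1 * _]mulrC.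
  rewrite big_ord_recr/= mulrDr -[F k.+1](subrK (F k)) addrC lerD//.
  by rewrite -mulrA [_^-1 * _]mulrC lo.
have := h n; rewrite big_ord_recr/= fn Fn mulrDr mulr1.
by rewrite -lerBlDr.
Qed.

(** Tangents at both ends of each mesh interval enclose the increments of [F], which telescope. The
    error is uniform in [S], hence in the scores. *)
Lemma riemann_sum_power :
  `| n%:R^-1 * (\sum_(k < n) expR (S * ln (k.+1%:R / n.+1%:R))) - (1 + S)^-1 | <= n%:R^-1.
Proof.
move: sum_up sum_lo; set G := \sum_(k < n) _ => hu hl.
have a1 : 1 <= 1 + S by rewrite lerDl.
have a0 : 0 < 1 + S by apply: lt_le_trans a1.
have nr : 0 < n%:R :> R by rewrite ltr0n.
have nr1 : n.+1%:R = n%:R + 1 :> R by rewrite -natr1.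
rewrite nr1 in hu hl.
have n10 : 0 < n%:R + 1 :> R by lra.
have hu' : (1 + S) * G <= n%:R + 1.
  by move: hu; rewrite mulrAC ler_pdivrMr// mul1r.
have hl' : n%:R + 1 - (1 + S) <= (1 + S) * G.
  move: hl; rewrite [_ / _ * _]mulrAC ler_pdivlMr// mulrBl mul1r divfK ?gt_eqF//.
have d : n%:R^-1 * G - (1 + S)^-1 = ((1 + S) * G - n%:R) / (n%:R * (1 + S)).
  by field; rewrite !gt_eqF.
rewrite d ler_norml; apply/andP; split.
  rewrite ler_pdivlMr ?mulr_gt0// mulNr mulKf ?gt_eqF//; lra.
by rewrite ler_pdivrMr ?mulr_gt0// mulKf ?gt_eqF//; lra.
Qed.

End RiemannSum.

Lemma count_grid (R : realType) (K : nat) (a : R) : (0 < K)%N -> 0 <= a < 1 ->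
  `| K%:R^-1 * \sum_(l < K) (l.+1%:R / K.+1%:R <= a)%R%:R - a | <= K%:R^-1.
Proof.
move=> K0 /andP[a0 a1]; have Kr : 0 < K%:R :> R by rewrite ltr0n.
have K1 : K.+1%:R = K%:R + 1 :> R by rewrite -natr1.
pose c := a * K.+1%:R; pose t := Num.truncn c.
have c0 : 0 <= c by rewrite mulr_ge0.
have tc : t%:R <= c < t.+1%:R by apply: truncn_itv.
have tK : (t <= K)%N.
  rewrite -ltnS -(ltr_nat R); case/andP: tc => tc _; apply: le_lt_trans tc _.
  by rewrite /c gtr_pMl.
have -> : \sum_(l < K) (l.+1%:R / K.+1%:R <= a :> R)%R%:R = t%:R :> R.
  rewrite -natr_sum; congr _%:R.
  have -> : (\sum_(i < K) (i.+1%:R / K.+1%:R <= a :> R)%R = \sum_(i < K) (i < t))%N.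
    apply: eq_bigr => i _; congr nat_of_bool.
    by rewrite ler_pdivrMr// -/c -truncn_ge_nat.
  rewrite -(subnKC tK) big_split_ord/= [X in (_ + X)%N]big1 ?addn0.
    by rewrite (eq_bigr (fun=> 1%N)) ?sum1_card ?card_ord// => i _; rewrite ltn_ord.
  by move=> i _; rewrite ltnNge leq_addr.
move: tc; rewrite -natr1 /c K1 => /andP[t1 t2].
have -> : K%:R^-1 * t%:R - a = (t%:R - a * K%:R) / K%:R by field; rewrite gt_eqF.
rewrite ler_norml ler_pdivlMr// ler_pdivrMr// mulNr mulVf ?gt_eqF//.
by apply/andP; split; lra.
Qed.

(** Factors are replaced one at a time; the induction also carries that the partial products stay in
    the unit interval. *)
Lemma distance_prod_le (R : realType) (I : finType) (A : pred I) (a b : I -> R) (e : R) :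
  (forall i, A i -> 0 <= a i <= 1) -> (forall i, A i -> 0 <= b i <= 1) ->
  (forall i, A i -> `|a i - b i| <= e) ->
  `|\prod_(i | A i) a i - \prod_(i | A i) b i| <= \sum_(i | A i) e.
Proof.
move=> a01 b01 ab.
suff [//] : [/\ `|\prod_(i | A i) a i - \prod_(i | A i) b i| <= \sum_(i | A i) e,
  0 <= \prod_(i | A i) a i <= 1 & 0 <= \prod_(i | A i) b i <= 1].
elim/big_rec3 : _ => [|i z y x Ai [IH x01 y01]].
  by split; rewrite ?subrr ?normr0 ?lexx ?ler01.
have := a01 i Ai; have := b01 i Ai; have := ab i Ai.
move: y01 x01 => /andP[y0 y1] /andP[x0 x1] abi /andP[bi0 bi1] /andP[ai0 ai1].
split; last 2 first.
- by rewrite mulr_ge0//= mulr_ile1.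
- by rewrite mulr_ge0//= mulr_ile1.
have -> : a i * x - b i * y = (a i - b i) * x + b i * (x - y) by ring.
apply: le_trans (ler_normD _ _) _; rewrite !normrM (ger0_norm x0) (ger0_norm bi0).
apply: lerD; first by apply: le_trans abi; rewrite ler_piMr.
by apply: le_trans IH; rewrite ler_piMl.
Qed.

(** For uniform [x] and [y], [ln (ln y / ln x)] is the difference of the standard Gumbel variables
    [- ln (- ln x)] and [- ln (- ln y)], the noises of the correct output and of a rival. *)
Lemma le_gumbel_threshold (R : realType) (x y t : R) : 0 < x < 1 -> 0 < y < 1 ->
  (t <= ln (ln y / ln x)) = (y <= expR (expR t * ln x)).
Proof.
move=> /andP[x0 x1] /andP[y0 y1].
have lx : ln x < 0 by rewrite ln_lt0// x0.
have ly : ln y < 0 by rewrite ln_lt0// y0.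
have p : 0 < ln y / ln x by rewrite nmulr_lgt0// invr_lt0.
rewrite -ler_expR lnK ?posrE// ler_ndivlMr//.
by rewrite -[RHS]ler_ln ?posrE ?expR_gt0// expRK.
Qed.

(* A discretized Gumbel-max trick: with [x] and the [y q] uniform,
   [y q <= x ^ (expR (t q))] has probability [x ^ (expR (t q))] given [x], and
   integrating the product over [x] yields [1 / (1 + \sum_q expR (t q))]. *)
Lemma gumbel_max_approx (R : realType) (r : nat) (eta : R) : 0 < eta ->
  exists (Om : finType) (g : Om -> 'I_r -> R), (0 < #|Om|)%N /\
    forall (A : pred 'I_r) (t : 'I_r -> R),
    `| #|Om|%:R^-1 * (\sum_o [forall q, A q ==> (t q <= g o q)]%:R)
       - (1 + \sum_(q | A q) expR (t q))^-1 | <= eta.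
Proof.
(* The error budget is [1 / n] for each of at most [r] factors and [1 / n] for the Riemann sum. *)
move=> eta0; pose n := (Num.truncn (r.+1%:R / eta)).+1.
have nr : 0 < n%:R :> R by rewrite ltr0n.
have n0 : (0 < n)%N by [].
have rn : r.+1%:R / n%:R <= eta.
  rewrite ler_pdivrMr// mulrC -ler_pdivrMr//.
  by apply/ltW/truncnS_gt.
pose x (k : 'I_n) : R := k.+1%:R / n.+1%:R.
have x01 k : 0 < x k < 1.
  by rewrite divr_gt0//= ltr_pdivrMr// mul1r ltr_nat ltnS ltn_ord.
exists ('I_n * {ffun 'I_r -> 'I_n})%type.
exists (fun (o : 'I_n * {ffun 'I_r -> 'I_n}) q => ln (ln (x (o.2 q)) / ln (x o.1))).
have cOm : #|{: 'I_n * {ffun 'I_r -> 'I_n}}| = (n * n ^ r)%N.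
  by rewrite card_prod card_ffun !card_ord.
split; first by rewrite cOm muln_gt0 n0 expn_gt0 n0.
move=> A t; rewrite cOm.
pose p k q : R := n%:R^-1 * \sum_(l < n) (x l <= expR (expR (t q) * ln (x k)))%R%:R.
have -> : (n * n ^ r)%:R^-1 *
    \sum_(o : 'I_n * {ffun 'I_r -> 'I_n})
      [forall q, A q ==> (t q <= ln (ln (x (o.2 q)) / ln (x o.1)))]%:R =
    n%:R^-1 * \sum_(k < n) \prod_(q | A q) p k q.
  (* The factor [1] outside [A] extends the product to all coordinates, so that the sum over noise
     vectors distributes. *)
  pose G k q l : R := if A q then (x l <= expR (expR (t q) * ln (x k)))%R%:R else 1.
  rewrite (eq_bigr (fun o : 'I_n * {ffun 'I_r -> 'I_n} => \prod_(q < r) G o.1 q (o.2 q))); last first.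
    move=> [k h] _ /=; case: forallP => [al|nal].
      rewrite big1// => q _; rewrite /G; case: ifP => // Aq.
      by rewrite -le_gumbel_threshold// (implyP (al q) Aq).
    have /forallPn[q] : ~~ [forall q, A q ==> (t q <= ln (ln (x (h q)) / ln (x k)))].
      by apply/forallP.
    rewrite negb_imply => /andP[Aq tq].
    by rewrite (bigD1 q)//= /G Aq -le_gumbel_threshold// (negbTE tq) mul0r.
  rewrite -(pair_bigA _ (fun k (h : {ffun 'I_r -> 'I_n}) => \prod_(q < r) G k q (h q)))/=.
  rewrite natrM invfM -mulrA; congr (_ * _); rewrite mulr_sumr; apply: eq_bigr => k _.
  rewrite -bigA_distr_bigA/= [RHS]big_mkcond/= natrX -exprVn.
  rewrite -[X in _ ^+ X]card_ord -prodr_const -big_split/=.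
  apply: eq_bigr => q _; rewrite /G /p; case: ifP => // Aq.
  by rewrite sumr_const card_ord mulVf// gt_eqF.
pose S := \sum_(q | A q) expR (t q).
have S0 : 0 <= S by apply: sumr_ge0 => q _; rewrite expR_ge0.
have b01 k q : 0 <= expR (expR (t q) * ln (x k)) < 1.
  rewrite expR_ge0/= expR_lt1 pmulr_rlt0 ?expR_gt0//.
  by rewrite ln_lt0.
have h1 k : `|\prod_(q | A q) p k q - expR (S * ln (x k))| <= r%:R / n%:R.
  have -> : expR (S * ln (x k)) = \prod_(q | A q) expR (expR (t q) * ln (x k)).
    by rewrite /S mulr_suml expR_sum.
  have : \sum_(q < r | A q) n%:R^-1 <= r%:R / n%:R :> R.
    rewrite sumr_const mulr_natl; apply: ler_wpMn2l; first by rewrite invr_ge0 ltW.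
    by rewrite -[leqRHS]card_ord max_card.
  apply: le_trans; apply: distance_prod_le => q Aq.
  - rewrite /p mulr_ge0 ?invr_ge0 ?(ltW nr) ?sumr_ge0//=.
    rewrite ler_pdivrMl// mulr1 -[n in leRHS]card_ord -sum1_card natr_sum.
    by apply: ler_sum => l _; rewrite lern1 leq_b1.
  - by have /andP[-> /ltW] := b01 k q.
  - exact: count_grid.
have := riemann_sum_power n0 S0; rewrite -/S => h2.
rewrite -(subrK (n%:R^-1 * \sum_(k < n) expR (S * ln (x k))) (n%:R^-1 * _)) -addrA.
apply: le_trans (ler_normD _ _) _; apply: le_trans rn.
rewrite -natr1 mulrDl mul1r; apply: lerD => //.
rewrite -mulrBr -sumrB normrM gtr0_norm ?invr_gt0// ler_pdivrMl//.
apply: le_trans (ler_norm_sum _ _ _) _.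
apply: le_trans (ler_sum _ (fun k _ => h1 k)) _.
by rewrite sumr_const card_ord [leRHS]mulr_natl.
Qed.

(** * Exponential moments of Rademacher sums *)

Lemma expR_jensen (R : realType) (I : finType) (w a : I -> R) :
  (forall i, 0 <= w i) -> \sum_i w i = 1 ->
  expR (\sum_i w i * a i) <= \sum_i w i * expR (a i).
Proof.
move=> w0 w1; set mu := \sum_i w i * a i.
apply: (@le_trans _ _ (\sum_i w i * (expR mu * (1 + (a i - mu))))); last first.
  by apply: ler_sum => i _; apply: ler_wpM2l => //; exact: expR_ge_tangent.
rewrite (eq_bigr (fun i => expR mu * (w i * (1 - mu) + w i * a i))); last first.
  by move=> i _; ring.
by rewrite -mulr_sumr big_split/= -mulr_suml w1 mul1r -/mu subrK mulr1.
Qed.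

(* With [h := x / 4], the bound [1 - h <= expR (- h)] controls
   [expR h - expR (- h)], and squaring twice returns to [x]. *)
Lemma expR_cosh_le (R : realType) (x : R) : expR x + expR (- x) <= 2 * expR (x ^+ 2).
Proof.
wlog x0 : x / 0 <= x.
  move=> h; have [/h//|/ltW x0] := leP 0 x.
  by rewrite addrC -sqrrN -{2}[x]opprK; apply: h; rewrite oppr_ge0.
have [x1|x1] := ltP 1 x.
  have -> : 2 * expR (x ^+ 2) = expR (x ^+ 2) + expR (x ^+ 2) by ring.
  have xx : x <= x ^+ 2 by rewrite expr2 ler_peMl// ltW.
  by apply: lerD; rewrite ler_expR//; apply: le_trans xx; lra.
apply: (@le_trans _ _ (2 * (1 + x ^+ 2))); last first.
  by rewrite ler_pM2l//; exact: expR_ge1Dx.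
pose h := x / 4; pose E := expR h; pose F := expR (- h).
have EF : E * F = 1 by rewrite -expRD subrr expR0.
have xh : x = h *+ 4 by rewrite /h -mulr_natr divfK.
have hxE : expR x = E ^+ 4 by rewrite xh -mulr_natl expRM_natl.
have hxF : expR (- x) = F ^+ 4 by rewrite xh -mulNrn -mulr_natl expRM_natl.
rewrite hxE hxF.
have h0 : 0 <= h by rewrite /h; lra.
have h1 : h <= 1 / 4 by rewrite /h; lra.
have E1 : 1 <= E by apply: le_trans (expR_ge1Dx h); lra.
have F1 : 1 - h <= F by exact: expR_ge1Dx.
have d0 : 0 <= E - F by nra.
have d1 : E - F <= 7 / 3 * h.
  have : E * (1 - h) <= 1 by rewrite -EF; nra.
  nra.
pose w := (E - F) ^+ 2.
have w1 : w <= 49 / 9 * h ^+ 2.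
  rewrite (_ : 49 / 9 * h ^+ 2 = (7 / 3 * h) ^+ 2); last by field.
  by rewrite /w ler_sqr ?nnegrE//; lra.
have w0 : 0 <= w by exact: sqr_ge0.
have e1 : E ^+ 2 + F ^+ 2 = 2 + w by rewrite /w sqrrB EF; ring.
have e2 : E ^+ 4 + F ^+ 4 = 2 + 4 * w + w ^+ 2.
  have -> : E ^+ 4 + F ^+ 4 = (E ^+ 2 + F ^+ 2) ^+ 2 - 2 * (E * F) ^+ 2 by ring.
  by rewrite e1 EF; ring.
rewrite e2 xh; have h2 : h ^+ 2 <= 1 / 16 by nra.
nra.
Qed.

(** The sum over sign vectors factors into one hyperbolic cosine per coordinate. *)
Lemma rademacher_mgf (R : realType) (m : nat) (lam : R) (x : 'I_m -> R) :
  (forall i, `|x i| <= 1) ->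
  \sum_(sg : {ffun 'I_m -> bool}) expR (lam * \sum_i (-1) ^+ sg i * x i)
    <= 2 ^+ m * expR (m%:R * lam ^+ 2).
Proof.
move=> x1.
under eq_bigr => sg _ do rewrite mulr_sumr expR_sum.
rewrite -(bigA_distr_bigA (fun i b => expR (lam * ((-1) ^+ nat_of_bool b * x i))))/=.
apply: (@le_trans _ _ (\prod_(i < m) (2 * expR (lam ^+ 2)))).
  apply: ler_prod => i _; rewrite sumr_ge0 => [|? _]; last exact: expR_ge0.
  rewrite big_bool/= expr1 expr0 mul1r mulN1r mulrN addrC.
  apply: le_trans (expR_cosh_le _) _; rewrite ler_pM2l// ler_expR exprMn.
  rewrite ler_piMr ?sqr_ge0// -[x i ^+ 2]ger0_norm ?sqr_ge0// normrX.
  by rewrite expr_le1.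
by rewrite prodr_const card_ord exprMn expRM_natl.
Qed.

(* One example: whether the correct output is feasible, and for each rival
   output the feature difference to the correct one. *)
Record example (R : realType) (d r : nat) := Example {
  feasible : bool;
  rival : pred 'I_r;
  gap : 'I_r -> 'rV[R]_d }.

(** The softmax probability with the weight of the correct output divided out; [v] stands for
    [w / beta]. *)
Definition example_prob (R : realType) (d r : nat) (z : example R d r) (v : 'rV[R]_d) : R :=
  if feasible z then (1 + \sum_(q | rival z q) expR (inner (gap z q) v))^-1 else 0.

(* The number of sign patterns is counted for each value [o] of the discretized
   noise separately; convexity of [expR] moves the average over [o] outside. *)
Lemma rademacher_selector_bound (R : realType) (d s r m : nat) (K : finType)
    (v : K -> 'rV[R]_d) (z : bool -> 'I_m -> example R d r)
    (kap : {ffun 'I_m -> bool} -> K) (lam eta : R) :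
  (0 < d)%N -> (forall k, sparse s (v k)) -> 0 <= lam -> 0 < eta ->
  \sum_(sg : {ffun 'I_m -> bool})
    expR (lam * \sum_i (-1) ^+ sg i *
      (example_prob (z false i) (v (kap sg)) - example_prob (z true i) (v (kap sg))))
  <= 2 ^+ m * (d ^ s * (2 * m * r).+1 ^ s)%:R
     * expR (m%:R * lam ^+ 2 + lam * (2 * m%:R * eta)).
Proof.
move=> d0 vs lam0 eta0.
have [Om [g [Om0 gP]]] := @gumbel_max_approx R r eta eta0.
have Or : 0 < #|Om|%:R :> R by rewrite ltr0n.
(* One halfspace per sample, index and rival; the pattern alone determines [ind], hence [Y]. *)
pose J : finType := ((bool * 'I_m) * 'I_r)%type.
pose ind (B : {set J}) b i := feasible (z b i) && [forall q, rival (z b i) q ==> ((b, i, q) \in B)].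
pose pat o k := [set j : J | inner (gap (z j.1.1 j.1.2) j.2) (v k) <= g o j.2]%SET.
pose Y (B : {set J}) (sg : {ffun 'I_m -> bool}) : R :=
  \sum_i (-1) ^+ sg i * ((ind B false i)%:R - (ind B true i)%:R).
have approx b i k : `|#|Om|%:R^-1 * \sum_o (ind (pat o k) b i)%:R
    - example_prob (z b i) (v k)| <= eta.
  rewrite /ind /example_prob; case: ifP => _ /=; last first.
    by rewrite big1// mulr0 subrr normr0 ltW.
  have := gP (rival (z b i)) (fun q => inner (gap (z b i) q) (v k)).
  rewrite (eq_bigr (fun o => [forall q, rival (z b i) q ==> ((b, i, q) \in pat o k)]%:R))//.
  move=> o _; congr (nat_of_bool _)%:R; apply: eq_forallb => q.
  by rewrite inE.
(* Replacing probabilities by noise averages costs [2 * m * eta] in total; Jensen's inequality then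
   moves the average outside [expR]. *)
have step (sg : {ffun 'I_m -> bool}) : expR (lam * \sum_i (-1) ^+ sg i *
      (example_prob (z false i) (v (kap sg)) - example_prob (z true i) (v (kap sg)))) <=
    expR (lam * (2 * m%:R * eta)) * \sum_o #|Om|%:R^-1 * expR (lam * Y (pat o (kap sg)) sg).
  set k := kap sg.
  have h : \sum_i (-1) ^+ sg i *
      (example_prob (z false i) (v k) - example_prob (z true i) (v k)) <=
      2 * m%:R * eta + \sum_o #|Om|%:R^-1 * Y (pat o k) sg.
    rewrite -lerBlDr -mulr_sumr /Y exchange_big/= mulr_sumr -sumrB.
    have -> : 2 * m%:R * eta = \sum_(i < m) (2 * eta).
      by rewrite sumr_const card_ord -mulr_natl; ring.
    apply: ler_sum => i _; rewrite -mulr_sumr sumrB mulrCA -mulrBr.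
    apply: le_trans (ler_norm _) _; rewrite normrM normrX normrN1 expr1n mul1r.
    have := approx false i k; have := approx true i k.
    set a := _ * _; set b := example_prob _ _; rewrite mulrBr.
    set a' := _ * _; set b' := example_prob _ _.
    rewrite -/a; rewrite !ler_norml => /andP[? ?] /andP[? ?].
    by apply/andP; split; lra.
  apply: (@le_trans _ _ (expR (lam * (2 * m%:R * eta)
     + \sum_o #|Om|%:R^-1 * (lam * Y (pat o k) sg)))).
    rewrite ler_expR; apply: le_trans (ler_wpM2l lam0 h) _; rewrite [leLHS]mulrDr lerD2l mulr_sumr.
    by apply: ler_sum => o _; rewrite mulrCA.
  rewrite expRD ler_wpM2l ?expR_ge0//; apply: expR_jensen.
    by move=> _; rewrite invr_ge0 ltW.
  by rewrite sumr_const -[LHS]mulr_natl mulfV// gt_eqF.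
apply: le_trans (ler_sum _ (fun sg _ => step sg)) _.
rewrite -mulr_sumr exchange_big/= [X in _ <= _ * expR X]addrC [expR (_ + _)]expRD [leRHS]mulrCA ler_wpM2l ?expR_ge0//.
have bnd o : \sum_(sg : {ffun 'I_m -> bool}) #|Om|%:R^-1 * expR (lam * Y (pat o (kap sg)) sg) <=
    #|Om|%:R^-1 * (2 ^+ m * (d ^ s * (2 * m * r).+1 ^ s)%:R * expR (m%:R * lam ^+ 2)).
  rewrite -mulr_sumr ler_wpM2l ?invr_ge0 ?(ltW Or)//.
  pose C := [set pat o k | k in K]%SET.
  (* Bounding one term by the sum over all patterns makes the pattern independent of the signs. *)
  apply: (@le_trans _ _ (\sum_(sg : {ffun 'I_m -> bool}) \sum_(B in C) expR (lam * Y B sg))).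
    apply: ler_sum => sg _; rewrite (bigD1 (pat o (kap sg)))/= ?imset_f// lerDl.
    by apply: sumr_ge0 => B _; exact: expR_ge0.
  rewrite exchange_big/=.
  apply: (@le_trans _ _ (\sum_(B in C) 2 ^+ m * expR (m%:R * lam ^+ 2))).
    apply: ler_sum => B _; apply: rademacher_mgf => i.
    by case: (ind B false i); case: (ind B true i);
      rewrite ?subrr ?subr0 ?sub0r ?normrN ?normr1 ?normr0.
  rewrite sumr_const -[leLHS]mulr_natl mulrA [X in X * _ <= _]mulrC.
  rewrite ler_wpM2r ?expR_ge0// ler_wpM2l ?exprn_ge0// ler_nat.
  apply: leq_trans (card_halfspace_patterns _ _ d0 vs) _.
  by rewrite !card_prod card_bool !card_ord.
apply: le_trans (ler_sum _ (fun o _ => bnd o)) _.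
by rewrite sumr_const -[leLHS]mulr_natl mulrA mulfV ?gt_eqF// mul1r.
Qed.

(** * Symmetrization on a finite sample space *)

Section FiniteSymmetrization.
Variables (R : realType) (Q K : finType) (m : nat) (p : Q -> R) (f : K -> Q -> R).
Hypotheses (p0 : forall x, 0 <= p x) (p1 : \sum_x p x = 1).

Let W (q : {ffun 'I_m -> Q}) : R := \prod_i p (q i).

Let W_ge0 q : 0 <= W q. Proof. exact: prodr_ge0. Qed.

Let sumW : \sum_q W q = 1.
Proof.
by rewrite -(bigA_distr_bigA (fun _ x => p x))/= big1.
Qed.

Let sumW_marginal i (F : Q -> R) : \sum_q W q * F (q i) = \sum_x p x * F x.
Proof.
pose G j x : R := p x * (if j == i then F x else 1).
rewrite (eq_bigr (fun q : {ffun 'I_m -> Q} => \prod_j G j (q j))); last first.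
  by move=> q _; rewrite big_split/= -big_mkcond/= big_pred1_eq.
rewrite -(bigA_distr_bigA G)/= (bigD1 i)//= [X in _ * X]big1 ?mulr1.
  by apply: eq_bigr => x _; rewrite /G eqxx.
by move=> j /negbTE ji; under eq_bigr do rewrite /G ji mulr1.
Qed.

Let swap (sg : {ffun 'I_m -> bool}) (qq : {ffun 'I_m -> Q} * {ffun 'I_m -> Q}) :
    {ffun 'I_m -> Q} * {ffun 'I_m -> Q} :=
  ([ffun i => if sg i then qq.2 i else qq.1 i],
   [ffun i => if sg i then qq.1 i else qq.2 i]).

Let swapK sg : involutive (swap sg).
Proof.
by case=> q q'; congr (_, _); apply/ffunP => i; rewrite !ffunE/=; case: ifP => sgi; rewrite ?ffunE ?sgi.
Qed.

Let W_swap sg qq : W (swap sg qq).1 * W (swap sg qq).2 = W qq.1 * W qq.2.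
Proof.
rewrite -!big_split/=; apply: eq_bigr => i _; rewrite !ffunE.
by case: ifP => // _; rewrite mulrC.
Qed.

Variables (lam eps C : R) (k0 : K).
Hypothesis lam0 : 0 <= lam.
(** The index may depend on the signs because a swap changes the sample it is selected from. *)
Hypothesis selC : forall (q : bool -> 'I_m -> Q) (kap : {ffun 'I_m -> bool} -> K),
  \sum_(sg : {ffun 'I_m -> bool})
    expR (lam * \sum_i (-1) ^+ sg i * (f (kap sg) (q false i) - f (kap sg) (q true i)))
  <= 2 ^+ m * C.

Lemma finite_symmetrization :
  \sum_(q : {ffun 'I_m -> Q} |
        [exists k, m%:R * eps < m%:R * (\sum_x p x * f k x) - \sum_i f k (q i)])
    \prod_i p (q i) <= expR (- (lam * (m%:R * eps))) * C.
Proof.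
pose bad q k := m%:R * eps < m%:R * (\sum_x p x * f k x) - \sum_(i < m) f k (q i).
(* The violator depends on the first sample only, so the ghost sample can be averaged with it fixed;
   [k0] is the default. *)
pose sel q := odflt k0 [pick k | bad q k].
pose H (qq : {ffun 'I_m -> Q} * {ffun 'I_m -> Q}) : R :=
  expR (lam * \sum_i (f (sel qq.1) (qq.2 i) - f (sel qq.1) (qq.1 i))).
pose T := \sum_qq W qq.1 * W qq.2 * H qq.
have T_le : T <= C.
  rewrite -(ler_pM2l (_ : 0 < 2 ^+ m)) ?exprn_gt0//.
  have -> : 2 ^+ m * T = \sum_(sg : {ffun 'I_m -> bool}) \sum_qq W qq.1 * W qq.2 * H (swap sg qq).
    rewrite (eq_bigr (fun=> T)); last first.
      move=> sg _; rewrite /T [RHS](reindex_inj (inv_inj (swapK sg)))/=.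
      by apply: eq_bigr => qq _; rewrite W_swap.
    by rewrite sumr_const card_ffun card_bool card_ord -[RHS]mulr_natl natrX.
  rewrite exchange_big/=.
  apply: (@le_trans _ _ (\sum_(qq : {ffun 'I_m -> Q} * {ffun 'I_m -> Q})
      W qq.1 * W qq.2 * (2 ^+ m * C))); last first.
    rewrite -mulr_suml -(pair_bigA _ (fun q q' => W q * W q'))/=.
    under eq_bigr do rewrite -mulr_sumr sumW mulr1.
    by rewrite sumW mul1r.
  apply: ler_sum => qq _; rewrite -mulr_sumr ler_wpM2l ?mulr_ge0//.
  apply: le_trans (selC (fun b => if b then qq.1 else qq.2) (fun sg => sel (swap sg qq).1)).
  apply: ler_sum => sg _; rewrite /H ler_expR ler_wpM2l//.
  apply: ler_sum => i _; rewrite !ffunE; case: ifP => _ /=.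
    by rewrite expr1 mulN1r opprB.
  by rewrite expr0 mul1r.
apply: (@le_trans _ _ (expR (- (lam * (m%:R * eps))) * T)); last first.
  by rewrite ler_wpM2l ?expR_ge0.
rewrite /T -(pair_bigA _ (fun q q' => W q * W q' * H (q, q')))/= mulr_sumr big_mkcond/=.
apply: ler_sum => q _.
rewrite [X in _ <= _ * X](eq_bigr (fun q' => W q * (W q' * H (q, q')))); last first.
  by move=> q' _; rewrite mulrA.
rewrite -mulr_sumr mulrCA; case: ifP => [/existsP[k kbad]|_]; last first.
  rewrite !mulr_ge0 ?expR_ge0//; apply: sumr_ge0 => q' _.
  by rewrite mulr_ge0// expR_ge0.
rewrite -/(W q) ler_peMr//.
(* For bad [q] the ghost average of the exponent is at least [lam * (m * eps)], so Jensen's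
   inequality makes the factor of [W q] at least [1]. *)
have := @expR_jensen R _ W
  (fun q' => lam * \sum_i (f (sel q) (q' i) - f (sel q) (q i))) W_ge0 sumW.
rewrite -/(H (q, _)) => /(ler_wpM2l (expR_ge0 (- (lam * (m%:R * eps))))).
apply: le_trans; rewrite -expRD -[leLHS]expR0 ler_expR.
under eq_bigr do rewrite mulrCA.
rewrite -mulr_sumr -mulrN -mulrDr mulr_ge0//.
have -> : \sum_(q' : {ffun 'I_m -> Q}) W q' * \sum_i (f (sel q) (q' i) - f (sel q) (q i)) =
    m%:R * (\sum_x p x * f (sel q) x) - \sum_i f (sel q) (q i).
  under eq_bigr do rewrite sumrB mulrBr mulr_sumr.
  rewrite sumrB -mulr_suml sumW mul1r exchange_big/=.
  under eq_bigr do rewrite sumW_marginal.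
  by rewrite sumr_const card_ord mulr_natl.
rewrite addrC subr_ge0 ltW// /sel; case: pickP => [//|/(_ k) nbad].
by move: kbad; rewrite -/(bad q k) nbad.
Qed.

End FiniteSymmetrization.

(** * Quantization of the sample space for finitely many losses *)

Lemma measure_bigsetU_le (R : realType) (d : measure_display) (T : measurableType d)
    (mu : {measure set T -> \bar R}) (I : finType) (A : pred I) (F : I -> set T) :
  (forall i, measurable (F i)) ->
  (mu (\big[setU/set0]_(i | A i) F i) <= \sum_(i | A i) mu (F i))%E.
Proof.
move=> mF; suff [] : measurable (\big[setU/set0]_(i | A i) F i) /\
  (mu (\big[setU/set0]_(i | A i) F i) <= \sum_(i | A i) mu (F i))%E by [].
elim/big_rec2 : _ => [|i x B _ [mB IH]]; first by rewrite measure0; split.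
split; first exact: measurableU.
by apply: le_trans (measureU2 _ _ _) _ => //; exact: leeD2l.
Qed.

Lemma probability_point (R : realType) (d : measure_display) (T : measurableType d)
  (P : probability T R) : exists t : T, True.
Proof.
apply: contrapT => nT; have := @probability_setT _ _ _ P.
have -> : [set: T] = set0 by apply/seteqP; split => // t _; case: nT; exists t.
by rewrite measure0 => /esym/eqP; rewrite onee_eq0.
Qed.

Lemma measurable_deviation (R : realType) (dT dO : measure_display)
    (T : measurableType dT) (Om : measurableType dO) (m : nat) (Z : 'I_m -> Om -> T)
    (e : T -> R) (a : R) (y : \bar R) :
  (forall i, measurable_fun setT (Z i)) -> measurable_fun setT e ->
  measurable [set om | ((a + m%:R^-1 * \sum_i e (Z i om))%:E < y)%E].
Proof.
move=> mZ me; rewrite -[X in measurable X]setTI.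
apply: (@emeasurable_fun_infty_o _ _ _ setT
  (fun om => (a + m%:R^-1 * \sum_i e (Z i om))%:E)) => //.
apply/measurable_EFinP/measurable_funD => //; apply: measurable_funM => //.
apply: measurable_sum => i; exact: measurableT_comp.
Qed.

Section FiniteFamily.
Variables (R : realType) (dT : measure_display) (T : measurableType dT).
Variables (D : probability T R) (K : finType) (e : K -> T -> R) (h : nat).
Hypotheses (me : forall k, measurable_fun setT (e k)).
Hypotheses (e01 : forall k z, 0 <= e k z <= 1) (h0 : (0 < h)%N).

(** A label rounds every loss down to a multiple of [1 / h]; the value [h] is reached by loss
    [1]. *)
Let Q : finType := {ffun K -> 'I_h.+1}.
Let c (z : T) : Q := [ffun k => inord (Num.truncn (h%:R * e k z))].

Let hr : 0 < h%:R :> R. Proof. by rewrite ltr0n. Qed.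

Let c_itv k z : (c z k)%:R <= h%:R * e k z < (c z k)%:R + 1.
Proof.
have /andP[e0 e1] := e01 k z.
have he0 : 0 <= h%:R * e k z by rewrite mulr_ge0.
have /andP[t1 t2] := truncn_itv he0.
rewrite ffunE inordK; first by rewrite t1 natr1.
rewrite ltnS -(ler_nat R); apply: le_trans t1 _.
by rewrite ler_piMr// ltW.
Qed.

Let cell_dist k z z' : c z = c z' -> e k z - e k z' <= h%:R^-1.
Proof.
move=> cz; have := c_itv k z; have := c_itv k z'; rewrite cz.
move=> /andP[a1 a2] /andP[b1 b2].
rewrite -(ler_pM2l hr) mulrBr divff ?gt_eqF//; lra.
Qed.

Let mcell q : measurable (c @^-1` [set q]).
Proof.
have -> : c @^-1` [set q] =
    \bigcap_(k in [set: K]) (e k @^-1` [set x | (q k)%:R <= h%:R * x < (q k)%:R + 1]).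
  apply/seteqP; split => z /=.
    by move=> <- k _ /=; exact: c_itv.
  move=> cz; apply/ffunP => k; apply/val_inj/eqP; have := cz k I => /= /andP[a1 a2].
  have /andP[b1 b2] := c_itv k z.
  have lt_leq (i j : nat) : i%:R < j%:R + 1 :> R -> (i <= j)%N.
    by rewrite natr1 ltr_nat ltnS.
  by rewrite eqn_leq !lt_leq// ?(le_lt_trans b1 a2)// (le_lt_trans a1 b2).
apply: fin_bigcap_measurable => [|k _]; first exact: finite_finset.
rewrite -[X in measurable X]setTI; apply: me => //.
have -> : [set x : R | (q k)%:R <= h%:R * x < (q k)%:R + 1] =
    `[(q k)%:R / h%:R, ((q k)%:R + 1) / h%:R[%classic.
  apply/seteqP; split => x /=; rewrite in_itv/= ler_pdivrMr// ltr_pdivlMr//;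
    by rewrite [x * _]mulrC.
exact: measurable_itv.
Qed.

Let p (q : Q) : R := fine (D (c @^-1` [set q])).

Let pE q : (p q)%:E = D (c @^-1` [set q]).
Proof. by rewrite /p fineK// fin_num_measure. Qed.

Let p_ge0 q : 0 <= p q. Proof. by rewrite fine_ge0. Qed.

Let cellsE (F : Q -> R) z : F (c z) = \sum_q F q * \1_(c @^-1` [set q]) z.
Proof.
rewrite (bigD1 (c z))//= big1 ?addr0; first by rewrite indicE mem_set// mulr1.
by move=> q qc; rewrite indicE memNset ?mulr0//= => cq; rewrite cq eqxx in qc.
Qed.

Let measurable_cells (F : Q -> R) : measurable_fun setT (fun z => F (c z)).
Proof.
under eq_fun do rewrite cellsE.
by apply: measurable_sum => q; apply: measurable_funM.
Qed.

Let integral_cells (F : Q -> R) : (forall q, 0 <= F q) ->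
  (\int[D]_z (F (c z))%:E = (\sum_q p q * F q)%:E)%E.
Proof.
move=> F0.
rewrite (eq_integral (fun z => \sum_(q : Q) (F q * \1_(c @^-1` [set q]) z)%:E)%E); last first.
  by move=> z _; rewrite sumEFin -cellsE.
rewrite ge0_integral_sum//; last first.
- by move=> q z _; rewrite lee_fin mulr_ge0// F0.
- move=> q; apply/measurable_EFinP; apply: measurable_funM => //.
rewrite -sumEFin; apply: eq_bigr => q _.
under eq_integral do rewrite EFinM.
rewrite ge0_integralZl//; last 2 first.
- exact/measurable_EFinP.
- by rewrite lee_fin.
by rewrite integral_indic// setIT EFinM pE muleC.
Qed.

Let p1 : \sum_q p q = 1.
Proof.
apply: EFin_inj; have := integral_cells (fun=> ler01).
rewrite integral_cst//= mul1e probability_setT => sum1; rewrite [RHS]sum1.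
by congr _%:E; apply: eq_bigr => q _; rewrite mulr1.
Qed.

Variables (m : nat) (hm : (0 < m)%N).
Variables (dO : measure_display) (Om : measurableType dO) (P : probability Om R).
Variables (Z : 'I_m -> Om -> T).
Hypotheses (hZmeas : forall i, measurable_fun setT (Z i)).
Hypotheses (hZlaw : forall i (B : set T), measurable B -> P (Z i @^-1` B) = D B).
Hypotheses (hZind : mutually_independent P Z).

Variables (lam eps C : R).
Hypothesis lam0 : 0 <= lam.
Hypothesis selC : forall (z : bool -> 'I_m -> T) (kap : {ffun 'I_m -> bool} -> K),
  \sum_(sg : {ffun 'I_m -> bool})
    expR (lam * \sum_i (-1) ^+ sg i * (e (kap sg) (z false i) - e (kap sg) (z true i)))
  <= 2 ^+ m * C.

(** Passing to cell representatives costs [1 / h] in the expectation and [1 / h] in the empirical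
    mean, hence [2 / h]. *)
Lemma finite_family_deviation (k0 : K) :
  (P [set om | exists k, ((eps + 2 / h%:R + m%:R^-1 * \sum_i e k (Z i om))%:E
                < \int[D]_z (e k z)%:E)%E]
   <= (expR (- (lam * (m%:R * eps))) * C)%:E)%E.
Proof.
have [t0 _] := probability_point D.
(* An empty cell, of mass zero, is represented by the arbitrary point [t0]. *)
pose rep q := xget t0 (c @^-1` [set q]).
have repP z : c (rep (c z)) = c z by apply: (@xgetI _ t0 (c @^-1` [set c z]) z).
pose f k q := e k (rep q).
have mr : 0 < m%:R :> R by rewrite ltr0n.
have fin := @finite_symmetrization R Q K m p f p_ge0 p1 lam eps C k0 lam0
  (fun q kap => selC (fun b i => rep (q b i)) kap).
rewrite -lee_fin in fin; apply: le_trans fin.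
pose box (q : {ffun 'I_m -> Q}) := \bigcap_(i in [set: 'I_m]) (Z i @^-1` (c @^-1` [set q i])).
have mbox q : measurable (box q).
  apply: fin_bigcap_measurable => [|i _]; first exact: finite_finset.
  by rewrite -[X in measurable X]setTI; exact: hZmeas.
have Pbox q : P (box q) = (\prod_i p (q i))%:E.
  rewrite hZind// -prodEFin; apply: eq_bigr => i _.
  by rewrite hZlaw.
rewrite -sumEFin; under eq_bigr do rewrite -Pbox.
apply: le_trans (measure_bigsetU_le _ _ mbox).
have Lf k : (\int[D]_z (e k z)%:E <= (\sum_q p q * f k q + h%:R^-1)%:E)%E.
  apply: (@le_trans _ _ (\int[D]_z (f k (c z) + h%:R^-1)%:E)%E); last first.
    have F0 q : 0 <= f k q + h%:R^-1.
      by rewrite addr_ge0 ?invr_ge0//; have /andP[] := e01 k (rep q).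
    rewrite (integral_cells F0) lee_fin.
    by under eq_bigr do rewrite mulrDr; rewrite big_split/= -mulr_suml p1 mul1r.
  apply: ge0_le_integral => //.
  - by move=> z _; rewrite lee_fin; have /andP[] := e01 k z.
  - exact/measurable_EFinP.
  - apply/measurable_EFinP; apply: measurable_funD => //.
  - move=> z _; rewrite lee_fin -lerBlDl; apply: cell_dist.
    by rewrite repP.
apply: le_measure; rewrite ?inE.
- have -> : [set om | exists k, ((eps + 2 / h%:R + m%:R^-1 * \sum_i e k (Z i om))%:E
                < \int[D]_z (e k z)%:E)%E] = \bigcup_(k in [set: K])
     [set om | ((eps + 2 / h%:R + m%:R^-1 * \sum_i e k (Z i om))%:E
                < \int[D]_z (e k z)%:E)%E].
    by apply/seteqP; split => om /= [k]; exists k.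
  apply: fin_bigcup_measurable => [|k _]; first exact: finite_finset.
  exact: measurable_deviation.
- by apply: bigsetU_measurable => q _.
move=> om /= [k devk].
pose q : {ffun 'I_m -> Q} := [ffun i => c (Z i om)].
have qom : box q om by move=> i _ /=; rewrite ffunE.
rewrite (bigD1 q)/=; first by left.
apply/existsP; exists k.
have := lt_le_trans devk (Lf k); rewrite lte_fin => dev.
have sumf : \sum_(i < m) f k (q i) <= \sum_(i < m) e k (Z i om) + m%:R * h%:R^-1.
  rewrite mulr_natl -[X in _ *+ X]card_ord -sumr_const -big_split/=.
  apply: ler_sum => i _; rewrite ffunE -lerBlDl; apply: cell_dist.
  by rewrite repP.
have {}dev : m%:R * (eps + 2 / h%:R) + \sum_(i < m) e k (Z i om) <
    m%:R * (\sum_x p x * f k x + h%:R^-1).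
  by rewrite -(ltr_pM2l mr) mulrDr mulrA divff ?gt_eqF// mul1r in dev.
move: dev sumf; rewrite !mulrDr; lra.
Qed.

End FiniteFamily.

(** * Softmax errors as examples, and the constants *)

Lemma innerBZ (R : realType) (d : nat) (u u' w : 'rV[R]_d) (c : R) :
  inner (u - u') (c *: w) = (inner u w - inner u' w) * c.
Proof.
rewrite /inner -sumrB mulr_suml; apply: eq_bigr => i _; rewrite !mxE; ring.
Qed.

Lemma sparseZ (R : realType) (d s : nat) (c : R) (w : 'rV[R]_d) :
  sparse s w -> sparse s (c *: w).
Proof.
apply: leq_trans; apply: subset_leq_card; apply/fintype.subsetP => i.
rewrite !in_setE /= mxE; apply: contra_neq => ->.
by rewrite mulr0.
Qed.

Lemma sparse0 (R : realType) (d s : nat) : sparse s (0 : 'rV[R]_d).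
Proof.
rewrite /sparse (eq_card0 (_ : _ =i pred0))// => i.
by apply/negbTE/negP; rewrite in_setE /= mxE eqxx.
Qed.

(** One occurrence of the correct output is removed from [Yx]; [rival] switches off the slots beyond
    the end of the remaining list. *)
Definition example_of (R : realType) (X : Type) (Y : eqType) (d r : nat)
    (phi : X -> Y -> 'rV[R]_d) (Yx : X -> seq Y) (z : X * Y) : example R d r :=
  let l := rem z.2 (Yx z.1) in
  Example (z.2 \in Yx z.1) (fun q => (q < size l)%N)
    (fun q => phi z.1 (nth z.2 l q) - phi z.1 z.2).

(** Dividing by the weight of the correct output turns scores into feature gaps against [w / beta]
    and leaves at most [r - 1] rivals. *)
Lemma err_example (R : realType) (X : Type) (Y : eqType) (d r : nat)
    (phi : X -> Y -> 'rV[R]_d) (Yx : X -> seq Y) (beta : R) (w : 'rV[R]_d) (z : X * Y) :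
  (size (Yx z.1) <= r)%N ->
  err phi Yx beta w z = 1 - example_prob (example_of r.-1 phi Yx z) (beta^-1 *: w).
Proof.
case: z => x y /= sr; rewrite /err /gibbs_prob /example_prob /=; congr (1 - _).
case: ifP => // yx; set l := rem y (Yx x).
have sl : (size l <= r.-1)%N by rewrite size_rem//; lia.
rewrite (perm_big _ (perm_to_rem yx))/= big_cons -/l.
have -> : \sum_(q < r.-1 | (q < size l)%N)
    expR (inner (phi x (nth y l q) - phi x y) (beta^-1 *: w)) =
    \sum_(y' <- l) expR (inner (phi x y') w / beta) / expR (inner (phi x y) w / beta).
  rewrite (big_nth y) big_mkord (big_ord_widen r.-1 (fun q =>
     expR (inner (phi x (nth y l q)) w / beta) / expR (inner (phi x y) w / beta))) //.
  by apply: eq_bigr => q _; rewrite innerBZ mulrBl expRB.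
rewrite -mulr_suml; set E := expR (inner (phi x y) w / beta).
have E0 : 0 < E by exact: expR_gt0.
set S := \sum_(y' <- l) _.
have S0 : 0 <= S by apply: sumr_ge0 => *; exact: expR_ge0.
by field; rewrite !gt_eqF//=; lra.
Qed.

Lemma example_prob01 (R : realType) (d r : nat) (z : example R d r) v :
  0 <= example_prob z v <= 1.
Proof.
rewrite /example_prob; case: ifP => _; last by rewrite lexx ler01.
have S0 : 0 <= \sum_(q | rival z q) expR (inner (gap z q) v).
  by apply: sumr_ge0 => *; exact: expR_ge0.
rewrite invr_ge0 addr_ge0//= invf_le1 ?lerDl//.
by rewrite ltr_wpDr.
Qed.

Lemma cvg_sumr (R : realType) (I : Type) (r : seq I) (P : pred I)
    (f : I -> nat -> R) (l : I -> R) :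
  (forall i, P i -> f i n @[n --> \oo] --> l i) ->
  \sum_(i <- r | P i) f i n @[n --> \oo] --> \sum_(i <- r | P i) l i.
Proof.
move=> fl; elim: r => [|i r IH].
  by under eq_fun do rewrite big_nil; rewrite big_nil; exact: cvg_cst.
under eq_fun do rewrite big_cons; rewrite big_cons.
by case: ifP => // Pi; apply: cvgD => //; exact: fl.
Qed.

Lemma cvg_example_prob (R : realType) (d r : nat) (z : example R d r)
    (v : nat -> 'rV[R]_d) (v0 : 'rV[R]_d) :
  (forall i, v n ord0 i @[n --> \oo] --> v0 ord0 i) ->
  example_prob z (v n) @[n --> \oo] --> example_prob z v0.
Proof.
move=> cv; rewrite /example_prob; case: ifP => _; last exact: cvg_cst.
have S0 : 0 <= \sum_(q | rival z q) expR (inner (gap z q) v0).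
  by apply: sumr_ge0 => *; exact: expR_ge0.
apply: cvgV; first by rewrite gt_eqF// ltr_wpDr.
apply: cvgD; first exact: cvg_cst.
apply: cvg_sumr => q _; apply: continuous_cvg; first exact: continuous_expR.
by apply: cvg_sumr => i _; apply: cvgM => //; exact: cvg_cst.
Qed.

(* The factor [2.9] in place of the theorem's [3] leaves room for the
   discretization errors [eta] and [2 / h]. *)
Lemma deviation_numerics (R : realType) (d s r m : nat) (delta lam a b eta eps : R) :
  (0 < d)%N -> (0 < r)%N -> (0 < m)%N -> 0 < delta -> delta < 1 ->
  a = Num.sqrt ((s%:R * (ln d%:R + 2 * ln (m%:R * r%:R))) / m%:R) ->
  b = Num.sqrt (ln (2 / delta) / (2 * m%:R)) ->
  lam = a + 29 / 20 * b -> 2 * a + 29 / 10 * b + 2 * eta <= eps ->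
  expR (- (lam * (m%:R * eps))) * ((d ^ s * (2 * m * r.-1).+1 ^ s)%:R
     * expR (m%:R * lam ^+ 2 + lam * (2 * m%:R * eta))) <= delta.
Proof.
move=> d0 r0 m0 del0 del1 aE bE lamE epsE.
have mr : 0 < m%:R :> R by rewrite ltr0n.
have dr : 1 <= d%:R :> R by rewrite ler1n.
have mrr : 1 <= m%:R * r%:R :> R by rewrite -natrM ler1n muln_gt0 m0.
have lnd : 0 <= ln d%:R :> R by rewrite ln_ge0.
have lnm : 0 <= ln (m%:R * r%:R) :> R by rewrite ln_ge0.
have lndel : 0 <= ln (2 / delta).
  by rewrite ln_ge0// ler_pdivlMr// mul1r; lra.
have a0 : 0 <= a by rewrite aE sqrtr_ge0.
have b0 : 0 <= b by rewrite bE sqrtr_ge0.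
have a2 : m%:R * a ^+ 2 = s%:R * (ln d%:R + 2 * ln (m%:R * r%:R)).
  rewrite aE sqr_sqrtr; last by rewrite divr_ge0// mulr_ge0// addr_ge0// mulr_ge0.
  by rewrite mulrCA divff ?gt_eqF// mulr1.
have b2 : m%:R * b ^+ 2 = ln (2 / delta) / 2.
  rewrite bE sqr_sqrtr; last by rewrite divr_ge0// mulr_ge0.
  by field; rewrite gt_eqF.
(* The count is controlled by [2 * m * (r - 1) + 1 <= (m * r) ^ 2]. *)
have N_le : (d ^ s * (2 * m * r.-1).+1 ^ s)%:R <= expR (m%:R * a ^+ 2) :> R.
  rewrite a2 expRM_natl expRD lnK ?posrE ?ltr0n//.
  rewrite [2 * ln _]mulrC expRM_natr lnK ?posrE; last exact: lt_le_trans mrr.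
  rewrite exprMn natrM !natrX; apply: ler_wpM2l; first by rewrite exprn_ge0.
  apply: lerXn2r; rewrite ?nnegrE// ?exprn_ge0//.
  rewrite -natrM -natrX ler_nat; case: r r0 {mrr lnm aE a2} => // r _ /=; nia.
have lam0 : 0 <= lam by rewrite lamE addr_ge0// mulr_ge0.
rewrite mulrCA -expRD.
(* Since [2 * lam = 2 * a + 29 / 10 * b], the bound on [eps] leaves at most [- m * lam ^ 2] in the
   exponent. *)
apply: (@le_trans _ _ (expR (m%:R * a ^+ 2) * expR (- (m%:R * lam ^+ 2)))).
  apply: ler_pM => //; rewrite ?expR_ge0// ler_expR.
  have : lam * m%:R * (2 * lam + 2 * eta) <= lam * m%:R * eps.
    by apply: ler_wpM2l; [rewrite mulr_ge0 ?(ltW mr)|rewrite lamE; lra].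
  by move=> h; lra.
rewrite -expRD.
apply: (@le_trans _ _ (expR (- ln (2 / delta)))); last first.
  by rewrite expRN lnK ?posrE ?divr_gt0// invf_div; lra.
rewrite ler_expR lamE.
have ab : 0 <= m%:R * (a * b) by rewrite !mulr_ge0// ltW.
(* Here [841 / 400 = (29 / 20) ^ 2], half of which exceeds [1] and so covers [ln (2 / delta)]. *)
have -> : m%:R * a ^+ 2 - m%:R * (a + 29 / 20 * b) ^+ 2 =
  - (29 / 10) * (m%:R * (a * b)) - 841 / 400 * (m%:R * b ^+ 2) by field.
rewrite b2; lra.
Qed.

Lemma probability_bigcup_le (R : realType) (dO : measure_display) (Om : measurableType dO)
    (P : probability Om R) (B : nat -> set Om) (x : \bar R) :
  (forall n, measurable (B n)) -> (forall n, B n `<=` B n.+1) ->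
  (forall n, (P (B n) <= x)%E) -> (P (\bigcup_n B n) <= x)%E.
Proof.
move=> mB incB Bx; have mU : measurable (\bigcup_n B n) by exact: bigcup_measurable.
have cP : (P \o B) n @[n --> \oo] --> P (\bigcup_n B n).
  apply: nondecreasing_cvg_mu => //; apply/nondecreasing_seqP => n.
  exact/subsetPset/incB.
rewrite -(cvg_lim _ cP)//; apply: lime_le; first by apply/cvg_ex; exists (P (\bigcup_n B n)).
exact: nearW.
Qed.

Lemma sparse_family_deviation (R : realType) (dX dY : measure_display)
  (X : measurableType dX) (Y : measurableType dY)
  (d s r : nat) (phi : X -> Y -> 'rV[R]_d) (Yx : X -> seq Y)
  (D : probability (X * Y)%type R) (m : nat) (delta : R)
  (dO : measure_display) (Om : measurableType dO) (P : probability Om R)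
  (Z : 'I_m -> Om -> (X * Y)%type) (K : finType) (k0 : K)
  (w : K -> 'rV[R]_d) (beta : K -> R) :
  (0 < d)%N -> (0 < r)%N -> (forall x, (size (Yx x) <= r)%N) -> (0 < m)%N ->
  0 < delta -> delta < 1 ->
  (forall k, sparse s (w k)) ->
  (forall k, measurable_fun setT (err phi Yx (beta k) (w k))) ->
  (forall i, measurable_fun setT (Z i)) ->
  (forall i (B : set (X * Y)%type), measurable B -> P (Z i @^-1` B) = D B) ->
  mutually_independent P Z ->
  (P [set om | exists k,
      ((2 * Num.sqrt ((s%:R * (ln d%:R + 2 * ln (m%:R * r%:R))) / m%:R)
        + 3 * Num.sqrt (ln (2 / delta) / (2 * m%:R))
        + m%:R^-1 * \sum_(i < m) err phi Yx (beta k) (w k) (Z i om))%:E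
       < \int[D]_z (err phi Yx (beta k) (w k) z)%:E)%E] <= delta%:E)%E.
Proof.
move=> d0 r0 Yr m0 del0 del1 ws me mZ Zlaw Zind.
set a := Num.sqrt (_ / m%:R); set b := Num.sqrt (_ / (2 * _)).
have b0 : 0 < b.
  rewrite sqrtr_gt0 divr_gt0 ?mulr_gt0 ?ltr0n// ln_gt0// ltr_pdivlMr// mul1r; lra.
(* Both [2 / h] and [2 * eta] are at most [b / 20], which together use the gap between [29 / 10 * b]
   and [3 * b]. *)
pose h := (Num.truncn (40 / b)).+1.
have hb : 2 / h%:R <= b / 20.
  have : 40 / b < h%:R by exact: truncnS_gt.
  rewrite ltr_pdivrMr// => hb.
  by rewrite ler_pdivrMr ?ltr0n//; lra.
pose eps := 2 * a + 3 * b - 2 / h%:R; pose eta := b / 40; pose lam := a + 29 / 20 * b.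
have lam0 : 0 <= lam by rewrite /lam addr_ge0 ?sqrtr_ge0// mulr_ge0// ltW.
have eta0 : 0 < eta by rewrite divr_gt0.
pose C : R := (d ^ s * (2 * m * r.-1).+1 ^ s)%:R
     * expR (m%:R * lam ^+ 2 + lam * (2 * m%:R * eta)).
have e01 k z : 0 <= err phi Yx (beta k) (w k) z <= 1.
  rewrite (err_example _ _ _ (Yr z.1)).
  have /andP[? ?] := example_prob01 (example_of r.-1 phi Yx z) ((beta k)^-1 *: w k).
  by apply/andP; split; lra.
have selC (z : bool -> 'I_m -> X * Y) (kap : {ffun 'I_m -> bool} -> K) :
    \sum_(sg : {ffun 'I_m -> bool}) expR (lam * \sum_i (-1) ^+ sg i *
      (err phi Yx (beta (kap sg)) (w (kap sg)) (z false i)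
       - err phi Yx (beta (kap sg)) (w (kap sg)) (z true i))) <= 2 ^+ m * C.
  (* An error is one minus a probability, so differences change sign; [~~ b'] exchanges the two
     samples to compensate. *)
  have := @rademacher_selector_bound R d s r.-1 m K (fun k => (beta k)^-1 *: w k)
    (fun b' i => example_of r.-1 phi Yx (z (~~ b') i)) kap lam eta d0
    (fun k => sparseZ _ (ws k)) lam0 eta0.
  rewrite -mulrA => /(le_trans _); apply; apply: ler_sum => sg _.
  rewrite ler_expR ler_wpM2l//; apply: ler_sum => i _ /=.
  rewrite !(err_example _ _ _ (Yr _)) le_eqVlt; apply/orP; left; apply/eqP; ring.
have := @finite_family_deviation R _ _ D K (fun k => err phi Yx (beta k) (w k)) h
  me e01 ltac:(by []) m m0 _ Om P Z mZ Zlaw Zind lam eps C lam0 selC k0.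
rewrite {1}/eps subrK => /le_trans; apply; rewrite lee_fin.
apply: (@deviation_numerics R d s r m delta lam a b eta eps) => //.
by rewrite /eps /eta; lra.
Qed.

(** * Countable approximation and the uniform bound *)

Lemma floor_dist (R : realType) (n : nat) (x y : R) :
  Num.floor (n.+1%:R * x) = Num.floor (n.+1%:R * y) -> `|x - y| <= n.+1%:R^-1.
Proof.
move=> xy; have := floor_itv (n.+1%:R * x); have := floor_itv (n.+1%:R * y).
rewrite xy intrD => /andP[y1 y2] /andP[x1 x2].
have n0 : 0 < n.+1%:R :> R by [].
rewrite -(ler_pM2l n0) divff// -[n.+1%:R in leLHS]gtr0_norm// -normrM mulrBr.
by rewrite ler_norml; apply/andP; split; lra.
Qed.

Lemma cvg_of_dist_le (R : realType) (u : nat -> R) (l : R) :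
  (forall n, `|u n - l| <= n.+1%:R^-1) -> u n @[n --> \oo] --> l.
Proof.
move=> ul; apply/cvgrPdist_le => e e0.
have : n.+1%:R^-1 @[n --> \oo] --> (0 : R) by exact: cvg_harmonic.
move/cvgrPdist_le/(_ e e0) => h; near=> n.
rewrite distrC; apply: le_trans (ul n) _.
have : `|0 - n.+1%:R^-1| <= e by near: n.
by rewrite sub0r normrN ger0_norm.
Unshelve. all: by end_near. Qed.

Theorem theorem1
  (R : realType)
  (dX dY : measure_display) (X : measurableType dX) (Y : measurableType dY)
  (d s r : nat) (phi : X -> Y -> 'rV[R]_d) (Yx : X -> seq Y)
  (hd : (0 < d)%N)
  (hYuniq : forall x, uniq (Yx x))
  (hYsize : forall x, (0 < size (Yx x) <= r)%N)
  (hphi : forall x y (i : 'I_d), y \in Yx x -> phi x y ord0 i != 0 -> 1 <= phi x y ord0 i)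
  (D : probability (X * Y)%type R)
  (hDsupp : D.-negligible [set z : X * Y | z.2 \notin Yx z.1])
  (m : nat) (hm : (1 <= m)%N)
  (delta : R) (hdelta0 : 0 < delta) (hdelta1 : delta < 1)
  (beta : nat -> 'rV[R]_d -> R) (hbeta : forall w, 0 < beta m w)
  (hmeas : forall w : 'rV[R]_d, sparse s w ->
     measurable_fun setT (err phi Yx (beta m w) w))
  (dO : measure_display) (Om : measurableType dO) (P : probability Om R)
  (Z : 'I_m -> Om -> (X * Y)%type)
  (hZmeas : forall i, measurable_fun setT (Z i))
  (hZlaw : forall i (B : set (X * Y)%type), measurable B -> P (Z i @^-1` B) = D B)
  (hZind : mutually_independent P Z) :
  exists A : set Om, measurable A /\ ((1 - delta)%:E <= P A)%E /\
    forall om, A om -> forall w : 'rV[R]_d, sparse s w ->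
      (\int[D]_(z in setT) (err phi Yx (beta m w) w z)%:E <=
        ((m%:R)^-1 * \sum_(i < m) err phi Yx (beta m w) w (Z i om)
         + 2 * Num.sqrt ((s%:R * (ln d%:R + 2 * ln (m%:R * r%:R))) / m%:R)
         + 3 * Num.sqrt (ln (2 / delta) / (2 * m%:R)))%:E)%E.
Proof.
have [[x0 y0] _] := probability_point D.
have r0 : (0 < r)%N by have /andP[a1 a2] := hYsize x0; exact: leq_trans a2.
have Yr x : (size (Yx x) <= r)%N by have /andP[] := hYsize x.
pose e w := err phi Yx (beta m w) w.
(* The scale may vary irregularly with [w], so [v w] is approximated instead: the loss depends on
   [w] only through it. *)
pose v w := (beta m w)^-1 *: w.
have eE w z : e w z = 1 - example_prob (example_of r.-1 phi Yx z) (v w).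
  by rewrite /e (err_example _ _ _ (Yr _)).
have e01 w z : 0 <= e w z <= 1.
  rewrite eE; have /andP[? ?] := example_prob01 (example_of r.-1 phi Yx z) (v w).
  by apply/andP; split; lra.
(* Recording the expected loss in the grid makes it converge without exchanging limit and
   integral. *)
pose L w := fine (\int[D]_z (e w z)%:E)%E.
have LE w : sparse s w -> (\int[D]_z (e w z)%:E = (L w)%:E)%E.
  move=> sw; rewrite /L fineK// ge0_fin_numE; last first.
    by apply: integral_ge0 => z _; rewrite lee_fin; have /andP[] := e01 w z.
  apply: le_lt_trans (_ : (\int[D]_z (cst 1%E z) < +oo)%E).
    apply: ge0_le_integral => //.
    - by move=> z _; rewrite lee_fin; have /andP[] := e01 w z.
    - apply/measurable_EFinP; exact: (hmeas w sw).
    - by move=> z _; rewrite lee_fin; have /andP[] := e01 w z.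
  by rewrite integral_cst//= mul1e probability_setT ltry.
(* [wseq] is dense for the pseudometric induced by [w |-> (v w, L w)]: it picks
   one sparse vector in each nonempty cell of every grid of mesh [1 / n.+1]. *)
pose code n w := ([ffun i : 'I_d => Num.floor (n.+1%:R * v w ord0 i)],
                  Num.floor (n.+1%:R * L w)).
pose cell (c : ({ffun 'I_d -> int} * int) * nat) :=
  [set w | sparse s w /\ code c.2 w = c.1].
pose wseq j := if @unpickle (({ffun 'I_d -> int} * int) * nat)%type j is Some c
  then xget 0 (cell c) else 0.
have wseq_sparse j : sparse s (wseq j).
  rewrite /wseq; case: unpickle => [c|]; last exact: sparse0.
  by case: xgetP => [? _ []|_] //; exact: sparse0.
have wseqP w n : sparse s w -> exists j, code n (wseq j) = code n w.
  move=> sw; exists (pickle (code n w, n)); rewrite /wseq pickleK.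
  by have [] := @xgetI _ 0 (cell (code n w, n)) w (conj sw erefl).
pose a := Num.sqrt ((s%:R * (ln d%:R + 2 * ln (m%:R * r%:R))) / m%:R) : R.
pose b := Num.sqrt (ln (2 / delta) / (2 * m%:R)).
pose dev w := [set om | ((2 * a + 3 * b + m%:R^-1 * \sum_(i < m) e w (Z i om))%:E
                         < \int[D]_z (e w z)%:E)%E].
have mdev j : measurable (dev (wseq j)).
  by apply: measurable_deviation => //; exact: hmeas.
(* Each [B n] involves finitely many vectors, so the finite bound holds with the same [delta] and
   passes to the increasing union. *)
pose B n := \bigcup_(k in [set: 'I_n.+1]) dev (wseq k).
have mB n : measurable (B n).
  by apply: fin_bigcup_measurable => // k _; exact: mdev.
have PB : (P (\bigcup_n B n) <= delta%:E)%E.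
  apply: probability_bigcup_le => // [n om [k _ kom]|n].
    by exists (widen_ord (leqnSn _) k).
  have := @sparse_family_deviation R dX dY X Y d s r phi Yx D m delta dO Om P Z
    'I_n.+1 ord0 (fun k => wseq k) (fun k => beta m (wseq k)) hd r0 Yr hm hdelta0 hdelta1
    (fun k => wseq_sparse k) (fun k => hmeas _ (wseq_sparse k)) hZmeas hZlaw hZind.
  apply: le_trans; rewrite le_eqVlt; apply/orP; left; apply/eqP; congr (P _).
  by apply/seteqP; split => om /= [k]; exists k.
have mU : measurable (\bigcup_n B n) by exact: bigcup_measurable.
exists (~` \bigcup_n B n); split; first exact: measurableC.
split.
  by rewrite probability_setC// EFinB; apply: leeB.
move=> om Aom w sw; rewrite -/(e w) LE// lee_fin -/a -/b.
have [j jP] := choice (fun n => wseqP w n sw).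
have vj i : v (wseq (j n)) ord0 i @[n --> \oo] --> v w ord0 i.
  apply: cvg_of_dist_le => n; apply: floor_dist.
  by have := jP n => -[/ffunP/(_ i)]; rewrite !ffunE.
have Lj : L (wseq (j n)) @[n --> \oo] --> L w.
  apply: cvg_of_dist_le => n; apply: floor_dist.
  by have := jP n => -[].
have ej i : e (wseq (j n)) (Z i om) @[n --> \oo] --> e w (Z i om).
  under eq_fun do rewrite eE; rewrite eE; apply: cvgB; first exact: cvg_cst.
  exact: cvg_example_prob.
have Ej : m%:R^-1 * (\sum_(i < m) e (wseq (j n)) (Z i om)) + 2 * a + 3 * b @[n --> \oo]
    --> m%:R^-1 * (\sum_(i < m) e w (Z i om)) + 2 * a + 3 * b.
  apply: cvgD; last exact: cvg_cst.
  apply: cvgD; last exact: cvg_cst.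
  by apply: cvgM; [exact: cvg_cst|apply: cvg_sumr].
apply: (ler_cvg_to Lj Ej); apply: nearW => n.
(* A violation at [wseq (j n)] would put [om] into [B (j n)], as its last index [ord_max]. *)
rewrite leNgt; apply/negP => dn; apply: Aom; exists (j n) => //.
exists ord_max => //=; rewrite /dev/= LE// lte_fin.
by apply: le_lt_trans dn; rewrite [leRHS]addrC addrA; lra.
Qed.
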